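(* Every maximum class $C\subseteq\{0,1\}^n$ of VC-dimension $2$ can be corner-peeled.
   Context: $C\subseteq\{0,1\}^n$ is maximum of VC-dimension $2$ if its VC-dimension is $2$ and $|C|=1+n+\binom{n}{2}$. One-inclusion graph $\Gamma(C)$: vertices $C$, edges between concepts differing in exactly one coordinate. A $k$-cube in $C$ is a set of $2^k$ points of $C$ agreeing outside some $k$ coordinates and taking all values on them. $C$ can be corner-peeled if there is an ordering $v_1,\dots,v_{|C|}$ of $C$ such that, with $C_0=C$ and $C_t=C_{t-1}\setminus\{v_t\}$, for each $t$ there is a unique cube $C'_{t-1}$ of maximum dimension among cubes contained in $C_{t-1}$ that contain $v_t$, and all neighbours of $v_t$ in $\Gamma(C_{t-1})$ lie in $C'_{t-1}$ (so that $C_{|C|}=\emptyset$). *)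

(* Defs.v *)
From mathcomp Require Import all_boot.
Set Implicit Arguments. Unset Strict Implicit. Unset Printing Implicit Defensive.

Definition point (n : nat) := {ffun 'I_n -> bool}.

Section Defs.
Variable n : nat.

Definition shattered (C : {set point n}) (S : {set 'I_n}) : Prop :=
  forall B : {set 'I_n}, B \subset S ->
    exists2 c, c \in C & [set i in S | c i] = B.

Definition VCdim_eq (C : {set point n}) (d : nat) : Prop :=
  (exists2 S, shattered C S & #|S| = d) /\
  (forall S, shattered C S -> #|S| <= d).

Definition maximum_VC2 (C : {set point n}) : Prop :=
  VCdim_eq C 2 /\ #|C| = 1 + n + 'C(n, 2).

Definition cubeset (K : {set 'I_n}) (b : point n) : {set point n} :=
  [set x : point n | [forall i, (i \notin K) ==> (x i == b i)]].

Definition is_cube (Q : {set point n}) (k : nat) : Prop :=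
  exists (K : {set 'I_n}) (b : point n), #|K| = k /\ Q = cubeset K b.

Definition adjacent (x y : point n) : bool :=
  #|[set i | x i != y i]| == 1.

Definition corner_step (D : {set point n}) (v : point n) : Prop :=
  exists (Q : {set point n}) (k : nat),
    [/\ is_cube Q k, Q \subset D, v \in Q,
        (forall (Q' : {set point n}) (k' : nat), is_cube Q' k' -> Q' \subset D -> v \in Q' ->
            k' <= k /\ (k' = k -> Q' = Q))
      & (forall y, y \in D -> adjacent v y -> y \in Q)].

Definition corner_peelable (C : {set point n}) : Prop :=
  exists s : seq (point n),
    [/\ uniq s, (forall x, (x \in s) = (x \in C))
      & forall t, t < size s ->
          corner_step (C :\: [set x in take t s]) (nth (nth [ffun=> false] s 0) s t)].
End Defs.

(* Main.v *)
Require Import Defs.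
From mathcomp Require Import all_boot.
From mathcomp Require Import zify.

(** C is built up from a single point by adding corners; reversing the order of
    insertion peels it. By Pajor's inequality, comparing |C| with the number of
    sets it shatters, a maximum class is ample, hence it and its reductions are
    isometric, and VC-dimension 2 makes the square of C in any two given
    directions unique. The set D built so far has a cube in every set of
    directions it shatters. If D <> C, take an f-edge of C leaving D. When D is
    constant on f, its outer end is a corner. Otherwise a descent along the
    hyperplanes of C yields a square of C with exactly three vertices in D,
    whose two directions are not shattered by D; the fourth vertex then has
    only two neighbours in D and can be added. *)

Set Implicit Arguments. Unset Strict Implicit. Unset Printing Implicit Defensive.

Section Points.
Variable n : nat.
Implicit Types (x y z v : point n) (i j f g h : 'I_n) (C D : {set point n}).

(** * Flips and Hamming distance *)

Definition flip x i : point n := [ffun j => x j (+) (j == i)].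

Lemma flipE x i j : flip x i j = x j (+) (j == i).
Proof. by rewrite ffunE. Qed.

Lemma flip_same x i : flip x i i = ~~ x i.
Proof. by rewrite flipE eqxx addbT. Qed.

Lemma flip_other x i j : j != i -> flip x i j = x j.
Proof. by rewrite flipE => /negbTE->; rewrite addbF. Qed.

Lemma flipK i : involutive (flip^~ i).
Proof. by move=> x; apply/ffunP=> j; rewrite !flipE -addbA addbb addbF. Qed.

Lemma flipC x i j : flip (flip x i) j = flip (flip x j) i.
Proof. by apply/ffunP=> k; rewrite !flipE addbAC. Qed.

Definition dist x y := #|[set i | x i != y i]|.

Lemma dist_sym x y : dist x y = dist y x.
Proof. by apply: eq_card => i; rewrite !inE eq_sym. Qed.

Lemma dist_gt0 x y : x != y -> 0 < dist x y.
Proof.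
move=> nxy; rewrite card_gt0; apply: contraNneq nxy => e0.
apply/eqP/ffunP=> i; apply/eqP; apply/negPn/negP=> ne.
by have := in_set0 i; rewrite -e0 inE ne.
Qed.

Lemma neq_point x y : x != y -> exists i, x i != y i.
Proof. by move/dist_gt0/card_gt0P=> [i]; rewrite inE; exists i. Qed.

Lemma dist_flip x y i : x i != y i -> dist (flip x i) y < dist x y.
Proof.
move=> nxy; apply/proper_card/properP; split.
  by apply/subsetP=> j; rewrite !inE flipE; have [->|_] := eqVneq j i; rewrite ?nxy // addbF.
by exists i; rewrite !inE ?flip_same //; case: (x i) (y i) nxy => [] [].
Qed.

Lemma dist_between x y z i :
  (forall j, x j = y j -> z j = x j) -> x i != y i -> z i = x i ->
  dist x z < dist x y.
Proof.
move=> btw nxy zi; apply/proper_card/properP; split; last first.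
  by exists i; rewrite !inE // zi eqxx.
by apply/subsetP=> j; rewrite !inE; apply: contraNneq => /btw->.
Qed.

Lemma adjacentP x y : adjacent x y -> exists i, y = flip x i.
Proof.
move/cards1P=> [i e]; exists i; apply/ffunP=> j; rewrite flipE -in_set1 -e inE.
by case: (x j) (y j) => [] [].
Qed.

(** * Shattering *)

(** Boolean counterpart of [shattered], phrased with patterns [b], so that the shattered sets form
    the finite set [shset C]. *)
Definition shatters C (S : {set 'I_n}) :=
  [forall b : point n, [exists c in C, [forall i in S, c i == b i]]].

Lemma shattersP C (S : {set 'I_n}) :
  reflect (forall b : point n, exists2 c, c \in C & {in S, c =1 b})
          (shatters C S).
Proof.
apply: (iffP forallP) => sh b.
  have /existsP[c /andP[Cc /forallP e]] := sh b.
  by exists c => // i iS; apply/eqP; have := e i; rewrite iS.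
have [c Cc e] := sh b; apply/existsP; exists c; rewrite Cc.
by apply/forallP=> i; apply/implyP=> /e->.
Qed.

Lemma shatters_shattered C (S : {set 'I_n}) : shatters C S -> shattered C S.
Proof.
move/shattersP=> sh B /subsetP BS; have [c Cc e] := sh [ffun i => i \in B].
exists c => //; apply/setP=> i; rewrite !inE.
case iS: (i \in S) => /=; first by rewrite e // ffunE.
by apply/esym/negbTE; apply: contraFN iS => /BS.
Qed.

Lemma sub_shatters C D (S : {set 'I_n}) :
  C \subset D -> shatters C S -> shatters D S.
Proof.
move/subsetP=> CD /shattersP sh; apply/shattersP=> b.
by have [c /CD Dc e] := sh b; exists c.
Qed.

Definition shset C := [set S | shatters C S].

Lemma shatters_const_notin C (S : {set 'I_n}) f (b : bool) :
  (forall x, x \in C -> x f = b) -> shatters C S -> f \notin S.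
Proof.
move=> Cf /shattersP sh; apply/negP=> fS.
have [c /Cf cf e] := sh [ffun=> ~~ b].
by have := e _ fS; rewrite ffunE cf; case: (b).
Qed.

(** Adding [f] to the members of [B] is injective and gives sets containing [f], hence none of those
    in [A]. *)
Lemma card_setU1_sum (A B X : {set {set 'I_n}}) f :
    (forall S, S \in A -> f \notin S /\ S \in X) ->
    (forall S, S \in B -> f \notin S /\ f |: S \in X) ->
  #|A| + #|B| <= #|X|.
Proof.
move=> hA hB.
have inj : {in B &, injective (fun S => f |: S)}.
  move=> S T /hB[fS _] /hB[fT _] e.
  by rewrite -(setU1K fS) -(setU1K fT) e.
rewrite -(card_in_imset inj).
have -> : #|A| + #|[set f |: S | S in B]| = #|A :|: [set f |: S | S in B]|.
  rewrite cardsU (_ : _ :&: _ = set0) ?cards0 ?subn0 //.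
  apply/setP=> S; rewrite !inE; apply/negbTE/negP=> /andP[/hA[fS _]].
  by case/imsetP=> T _ e; rewrite e setU11 in fS.
apply/subset_leq_card/subsetP=> S; rewrite inE => /orP[/hA[]//|].
by case/imsetP=> T /hB[_ TX] ->.
Qed.

Definition face C f b := [set x in C | x f == b].

Lemma in_face C f b x : (x \in face C f b) = (x \in C) && (x f == b).
Proof. by rewrite inE. Qed.

Lemma face_sub C f b : face C f b \subset C.
Proof. by apply/subsetP=> x; rewrite in_face => /andP[]. Qed.

Lemma shatters_face_notin C (S : {set 'I_n}) f b : shatters (face C f b) S -> f \notin S.
Proof.
by apply: (@shatters_const_notin _ _ _ b) => x; rewrite in_face => /andP[_ /eqP].
Qed.

Lemma card_face C f : #|C| = #|face C f true| + #|face C f false|.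
Proof.
rewrite -cardsUI (_ : face C f true :&: _ = set0) ?cards0 ?addn0.
  congr #|pred_of_set _|; apply/setP=> x; rewrite !inE -andb_orr.
  by case: (x f); rewrite andbT.
by apply/setP=> x; rewrite !inE; case: (x f); rewrite ?andbF.
Qed.

Lemma shatters_setU1 C (S : {set 'I_n}) f :
  shatters (face C f true) S -> shatters (face C f false) S ->
  shatters C (f |: S).
Proof.
move=> /shattersP sh1 /shattersP sh0; apply/shattersP=> b.
have [c]: exists2 c, c \in face C f (b f) & {in S, c =1 b}.
  by case: (b f).
rewrite in_face => /andP[Cc /eqP cf] e; exists c => // i.
by rewrite in_setU1 => /predU1P[->|/e].
Qed.

(** A set shattered by some face counts once for [C]; one shattered by both faces counts again with
    [f] added. *)
Lemma leq_shset_face C f :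
  #|shset (face C f true)| + #|shset (face C f false)| <= #|shset C|.
Proof.
rewrite -cardsUI; apply: (@card_setU1_sum _ _ _ f) => S; rewrite !inE.
  by case/orP=> sh; split; [exact: shatters_face_notin sh| |exact: shatters_face_notin sh|];
    apply: sub_shatters sh; apply: face_sub.
case/andP=> sh1 sh0; split; last exact: shatters_setU1.
exact: shatters_face_notin sh1.
Qed.

(** Pajor's inequality: split along a coordinate on which two points differ, so that both faces are
    smaller, and add their bounds. *)
Lemma card_leq_shset C : #|C| <= #|shset C|.
Proof.
have [m] := ubnP #|C|; elim: m C => // m IH C lt.
have [|/card_gt1P[x [y [Cx Cy nxy]]]] := leqP #|C| 1.
  case: (posnP #|C|) => [->//|/card_gt0P[c Cc] /leq_trans-> //].
  apply/card_gt0P; exists set0; rewrite inE; apply/shattersP=> b.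
  by exists c => // i; rewrite inE.
have [f nf] := neq_point nxy.
apply: leq_trans (leq_shset_face C f).
have [c1 c0] : 0 < #|face C f true| /\ 0 < #|face C f false|.
  split; apply/card_gt0P; [exists (if x f then x else y)|exists (if x f then y else x)];
    by move: nf; case xf: (x f); case yf: (y f); rewrite // in_face ?Cx ?Cy ?xf ?yf.
by rewrite (card_face C f) in lt *; apply: leq_add; apply: IH; lia.
Qed.

(** * Ample classes *)

Definition ample C := #|shset C| <= #|C|.

(** The inequalities for the two faces add up to the one for [C]; equality there forces equality in
    both. *)
Lemma ample_face C f b : ample C -> ample (face C f b).
Proof.
rewrite /ample (card_face C f) => am; have := leq_shset_face C f.
have := card_leq_shset (face C f true); have := card_leq_shset (face C f false).
by case: b; lia.
Qed.

(** The [f]-edges of [C], each encoded by its end with value [false] at [f], which avoids passing to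
    a cube of dimension n - 1. *)
Definition reduction C f := [set x in C | ~~ x f & flip x f \in C].

Lemma in_reduction C f x :
  (x \in reduction C f) = [&& x \in C, ~~ x f & flip x f \in C].
Proof. by rewrite inE. Qed.

(** The size of [C] is that of its projection along [f] plus that of its reduction. Sets [S]
    shattered by the projection and sets [f |: S] with [S] shattered by the reduction are all
    shattered by [C], so Pajor's inequality for the projection leaves the bound for the
    reduction. *)
Lemma ample_reduction C f : ample C -> ample (reduction C f).
Proof.
rewrite /ample => am.
(* [C1] is the upper face moved down: its union with the lower face is the projection of [C], its
   intersection with it the reduction. *)
pose C1 := [set flip x f | x in face C f true].
have in_C1 x : (x \in C1) = ~~ x f && (flip x f \in C).
  rewrite -{1}(flipK f x) (@mem_imset _ _ (flip^~ f)); last exact/inv_inj/flipK.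
  by rewrite in_face flip_same eqb_id andbC.
have cC1 : #|C1| = #|face C f true| by apply/card_imset/inv_inj/flipK.
have eR : reduction C f = C1 :&: face C f false.
  apply/setP=> x; rewrite !inE in_C1 eqbF_neg.
  by case: (x \in C); case: (x f); rewrite ?andbT ?andbF.
have cC : #|C| = #|C1 :|: face C f false| + #|reduction C f|.
  by rewrite eR cardsUI cC1 -card_face.
have le : #|shset (C1 :|: face C f false)| + #|shset (reduction C f)| <= #|shset C|.
  apply: (@card_setU1_sum _ _ _ f) => S; rewrite !inE => sh.
    have fS : f \notin S.
      apply: (@shatters_const_notin _ _ _ false) sh => x.
      by rewrite inE in_C1 in_face => /orP[/andP[/negbTE]|/andP[_ /eqP]].
    split=> //; apply/shattersP=> b; have [c] := shattersP _ _ sh b.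
    rewrite inE in_C1 in_face => /orP[/andP[_ Cc]|/andP[Cc _]] e; last by exists c.
    exists (flip c f) => // i iS; rewrite flip_other ?e //.
    by apply: contraNneq fS => <-.
  have fS : f \notin S.
    by apply: (@shatters_const_notin _ _ _ false) sh => x; rewrite in_reduction => /and3P[_ /negbTE].
  split=> //; apply: shatters_setU1; apply/shattersP=> b;
    have [c] := shattersP _ _ sh b; rewrite in_reduction => /and3P[Cc cf Ccf] e.
    exists (flip c f); first by rewrite in_face Ccf flip_same cf.
    by move=> i iS; rewrite flip_other ?e //; apply: contraNneq fS => <-.
  by exists c; rewrite // in_face Cc eqbF_neg.
rewrite -(leq_add2l #|C1 :|: face C f false|) -cC.
by apply: leq_trans am; apply: leq_trans le; rewrite leq_add2r card_leq_shset.
Qed.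

(* Equivalently, the one-inclusion graph of C is an isometric subgraph of the cube. *)
Definition isometric C := forall x y, x \in C -> y \in C -> x != y ->
  exists2 i, x i != y i & flip x i \in C.

Lemma ample_subcube C x (s : seq 'I_n) :
  ample C -> ample [set z in C | all (fun i => z i == x i) s].
Proof.
move=> am; elim: s => [|i s IH].
  by rewrite (_ : [set z in C | _] = C) //; apply/setP=> z; rewrite inE andbT.
rewrite (_ : [set z in C | _] = face [set z in C | all (fun i => z i == x i) s] i (x i)).
  exact: ample_face.
by apply/setP=> z; rewrite !inE /= -andbA [all _ _ && _]andbC.
Qed.

(** The part of [C] between [x] and [y] is ample. If they differ at two coordinates, it shatters the
    empty set and two singletons, so it has a third point [z], and induction applies to [x] and
    [z]. *)
Lemma ample_isometric C : ample C -> isometric C.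
Proof.
move=> am x y; have [m] := ubnP (dist x y); elim: m y => // m IH y lt Cx Cy nxy.
have [|d2] := leqP (dist x y) 1.
  move=> d1; have [i ni] := neq_point nxy; exists i => //.
  suff -> : flip x i = y by [].
  apply/eqP/negPn/negP=> /dist_gt0.
  by rewrite ltnNge -ltnS (leq_trans (dist_flip ni)).
pose s := enum [pred i | x i == y i].
pose I := [set z in C | all (fun i => z i == x i) s].
have inI z : z \in I -> z \in C /\ forall j, x j = y j -> z j = x j.
  rewrite inE => /andP[Cz /allP e]; split=> // j ej; apply/eqP/e.
  by rewrite mem_enum inE ej.
have Ix : x \in I by rewrite inE Cx; apply/allP=> i _.
have Iy : y \in I.
  by rewrite inE Cy; apply/allP=> i; rewrite mem_enum inE => /eqP->.
have shI i : x i != y i -> [set i] \in shset I.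
  move=> ni; rewrite inE; apply/shattersP=> b.
  have [e|e] := eqVneq (x i) (b i); [exists x|exists y] => // j /set1P-> //.
  by case: (x i) (y i) (b i) ni e => [] [] [].
have [i [j [ni nj nij]]] := card_gt1P d2.
rewrite !inE in ni nj.
have : 2 < #|I|.
  apply: leq_trans (ample_subcube x s am).
  have -> : 3 = #|[set set0; [set i]; [set j]]|.
    by rewrite -setUA !cardsU1 cards1 !inE !(eq_sym set0) (inj_eq set1_inj) nij
               -!cards_eq0 !cards1.
  apply/subset_leq_card/subsetP=> S; rewrite !inE -orbA => /or3P[]/eqP->.
  - by apply/shattersP=> b; exists x => // k; rewrite inE.
  - by have := shI _ ni; rewrite inE.
  - by have := shI _ nj; rewrite inE.
move=> cI.
have /card_gt0P[z] : 0 < #|I :\: [set x; y]|.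
  rewrite cardsD subn_gt0; apply: leq_ltn_trans cI.
  by apply: leq_trans (subset_leq_card (subsetIr _ _)) _; rewrite cards2 nxy.
rewrite in_setD in_set2 negb_or => /andP[/andP[nzx nzy] /inI[Cz btw]].
have [k nk] := neq_point nzy.
have zk_btw l : x l != z l -> x l != y l.
  by apply: contraNneq => /btw->.
have xyk : x k != y k by apply: contraNneq nk => e; rewrite -e btw.
have zx : z k = x k by case: (z k) (x k) (y k) nk xyk => [] [] [].
have [||||l nl Cl] // := IH z.
- exact: leq_trans (dist_between btw xyk zx) lt.
- by rewrite eq_sym.
by exists l; first exact: zk_btw.
Qed.

(** A shortest path in [C] from [x] to [y] crosses direction [h]; [z] is the end of the crossing
    edge on the side of [x]. *)
Lemma isometric_edge C x y h : isometric C -> x \in C -> y \in C -> x h != y h ->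
  exists z, [/\ z \in C, flip z h \in C, z h = x h
              & forall i, x i = y i -> z i = x i].
Proof.
move=> iC; have [m] := ubnP (dist x y); elim: m x => // m IH x lt Cx Cy nh.
have nxy : x != y by apply: contraNneq nh => ->.
have [i ni Ci] := iC x y Cx Cy nxy.
have [ih|nih] := eqVneq i h; first by subst i; exists x.
have [||||z [Cz Czh zh btw]] // := IH (flip x i).
- exact: leq_trans (dist_flip ni) lt.
- by rewrite flip_other // eq_sym.
exists z; split=> //; first by rewrite zh flip_other // eq_sym.
move=> j ej; have nji : j != i by apply: contraNneq ni => <-; rewrite ej.
by rewrite btw flip_other.
Qed.

(** * Edges in a fixed direction *)

Definition edge_ends C f := [set x in C | flip x f \in C].

Lemma in_edge_ends C f x : (x \in edge_ends C f) = (x \in C) && (flip x f \in C).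
Proof. by rewrite inE. Qed.

Lemma flip_edge_ends C f x : (flip x f \in edge_ends C f) = (x \in edge_ends C f).
Proof. by rewrite !in_edge_ends flipK andbC. Qed.

Definition lower x f := if x f then flip x f else x.

Lemma lower_same x f : lower x f f = false.
Proof. by rewrite /lower; case e: (x f); rewrite // flip_same e. Qed.

Lemma lower_other x f i : i != f -> lower x f i = x i.
Proof. by rewrite /lower; case: (x f) => // /flip_other->. Qed.

Lemma lower_flip x f i : i != f -> lower (flip x i) f = flip (lower x f) i.
Proof.
by move=> nif; rewrite /lower flip_other 1?eq_sym //; case: (x f); rewrite // flipC.
Qed.

Lemma in_reduction_lower C f x :
  (lower x f \in reduction C f) = (x \in edge_ends C f).
Proof.
rewrite in_reduction lower_same in_edge_ends /lower.
by case: (x f); rewrite ?flipK //= andbC.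
Qed.

Lemma lower_eq x y f : lower x f = lower y f -> forall i, i != f -> x i = y i.
Proof. by move=> e i nif; rewrite -(lower_other x nif) e lower_other. Qed.

(** A step between lower ends in the ample reduction lifts to either end of the edges; if the lower
    ends coincide, only [f] is left to flip. *)
Lemma edge_ends_isometric C f : ample C -> isometric (edge_ends C f).
Proof.
move=> am x y Ux Uy nxy.
have [e|ne] := eqVneq (lower x f) (lower y f).
  have [i ni] := neq_point nxy.
  have ef : i = f by apply: contraNeq ni => /(lower_eq e)->.
  by exists i => //; rewrite ef flip_edge_ends.
have := ample_isometric (ample_reduction f am) _ _ ne.
rewrite !in_reduction_lower => /(_ Ux Uy)[i ni].
have nif : i != f by apply: contraNneq ni => ->; rewrite !lower_same.
rewrite -lower_flip // in_reduction_lower => Ui; exists i => //.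
by rewrite !lower_other in ni.
Qed.

(** * Squares of a two-dimensional ample class *)

Definition square C x f g :=
  [&& x \in C, flip x f \in C, flip x g \in C & flip (flip x f) g \in C].

Definition vc_le2 C := forall S, shatters C S -> #|S| <= 2.

(** Encodes squares as points of the double reduction, which inherits ampleness. *)
Lemma in_reduction2_lower C f g x : f != g ->
  (lower (lower x f) g \in reduction (reduction C f) g) = square C x f g.
Proof.
move=> nfg; rewrite in_reduction_lower in_edge_ends -lower_flip 1?eq_sym //.
rewrite !in_reduction_lower !in_edge_ends /square (flipC x g f).
by case: (x \in C); case: (flip x f \in C).
Qed.

Lemma shatters_cube3 C x f g h : f != g -> f != h -> g != h ->
  square C x f g -> square C (flip x h) f g -> shatters C [set f; g; h].
Proof.
move=> fg fh gh /and4P[C0 Cf Cg Cfg] /and4P[Ch Chf Chg Chfg].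
apply/shattersP=> b.
pose a (c : bool) (y : point n) i := if c then flip y i else y.
(* Start at [x] and flip each of [h], [f], [g] on which [x] disagrees with [b]. *)
exists (a (x g != b g) (a (x f != b f) (a (x h != b h) x h) f) g).
  by rewrite /a; case: (x f != b f); case: (x g != b g); case: (x h != b h).
have aE c y i j : a c y i j = y j (+) (c && (j == i)).
  by rewrite /a; case: c; rewrite ?flipE // addbF.
move: fg fh gh => /negbTE fg /negbTE fh /negbTE gh.
have sw i j (e : (i == j) = false) : (j == i) = false by rewrite eq_sym.
move=> i; rewrite !inE !aE -orbA => /or3P[]/eqP->;
  rewrite ?eqxx ?(fg, fh, gh, sw _ _ fg, sw _ _ fh, sw _ _ gh) ?andbT ?andbF ?addbF;
  by case: (x _) (b _) => [] [].
Qed.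

(** Two squares would be distinct points of the isometric double reduction. A step [h] from one
    towards the other gives an adjacent parallel square, hence three shattered directions. *)
Lemma square_unique C x y f g : ample C -> vc_le2 C -> f != g ->
  square C x f g -> square C y f g ->
  forall i, i != f -> i != g -> x i = y i.
Proof.
move=> am vc nfg sx sy.
suff e : lower (lower x f) g = lower (lower y f) g.
  by move=> i nf ng; have := lower_eq e ng; rewrite !lower_other.
apply/eqP/negPn/negP=> ne.
have := ample_isometric (ample_reduction g (ample_reduction f am)) _ _ ne.
rewrite !in_reduction2_lower // => /(_ sx sy)[h nh].
have nhg : h != g by apply: contraNneq nh => ->; rewrite !lower_same.
have nhf : h != f.
  by apply: contraNneq nh => ->; rewrite !(lower_other _ nfg) !lower_same.
rewrite -!lower_flip // in_reduction2_lower // => sxh.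
have := vc _ (shatters_cube3 nfg _ _ sx sxh); rewrite eq_sym => /(_ nhf).
rewrite eq_sym => /(_ nhg).
by rewrite -setUA !cardsU1 cards1 !inE negb_or nfg [f == h]eq_sym nhf [g == h]eq_sym nhg.
Qed.

Lemma eq_square C x y f g : f != g ->
  (forall i, i != f -> i != g -> x i = y i) -> square C x f g = square C y f g.
Proof.
move=> nfg e; rewrite -!in_reduction2_lower //.
suff -> : lower (lower x f) g = lower (lower y f) g by [].
apply/ffunP=> i; have [->|ng] := eqVneq i g; first by rewrite !lower_same.
rewrite !(lower_other _ ng); have [->|nf] := eqVneq i f; first by rewrite !lower_same.
by rewrite !lower_other // e.
Qed.

(* Inside a class of VC-dimension 2, this says that every shattered set is the
   set of directions of a cube. *)
Definition cubical2 D :=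
  (forall x y f, x \in D -> y \in D -> x f != y f ->
     exists z, z \in edge_ends D f) /\
  (forall f g, f != g ->
     (forall a b, exists z, [/\ z \in D, z f = a & z g = b]) ->
     exists z, square D z f g).

(** * Finding a corner outside D *)

Section Growth.
Variables C D : {set point n}.
Hypotheses (ampleC : ample C) (vcC : vc_le2 C) (sDC : D \subset C) (cubD : cubical2 D).

(* The square of C in directions f, g is unique, so if it is not in D then D
   misses one of the four patterns on f, g. *)
Lemma missing_pattern f g x u v w z : f != g ->
    square C x f g -> ~~ square D x f g ->
    u \in D -> v \in D -> w \in D -> z \in D ->
    v f != u f -> v g = u g -> w f = u f -> w g != u g ->
  z f != u f -> z g = u g.
Proof.
move=> nfg sx nsx Du Dv Dw Dz vf vg wf wg zf; apply/eqP/negPn/negP=> zg.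
(* Otherwise [u], [v], [w], [z] realize all four patterns, so [D] has a square in directions [f],
   [g], which by uniqueness in [C] is the one at [x]. *)
have [a b|y sy] := cubD.2 f g nfg.
  have [->|na] := eqVneq a (u f); have [->|nb] := eqVneq b (u g).
  - by exists u.
  - by exists w; split=> //; case: (w g) (u g) b wg nb => [] [] [].
  - by exists v; split=> //; case: (v f) (u f) a vf na => [] [] [].
  exists z; split=> //; last by case: (z g) (u g) b zg nb => [] [] [].
  by case: (z f) (u f) a zf na => [] [] [].
case/negP: nsx; have sDy : square C y f g.
  by case/and4P: sy => *; apply/and4P; split; apply: (subsetP sDC).
by rewrite (eq_square D nfg (square_unique ampleC vcC nfg sx sDy)).
Qed.

Lemma edge_square x f g :
  x \in edge_ends C f -> flip x g \in edge_ends C f -> square C x f g.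
Proof.
by rewrite !in_edge_ends /square flipC => /andP[-> ->] /andP[-> ->].
Qed.

(* Descent: from an f-edge of C at p leaving D, walk from the f-edge of D
   nearest to p towards p; the first step g either completes a square or
   leaves D, and then the g-edge of D nearest to q is closer to q than p. *)
Lemma exists_corner_square f p q :
    p \in D -> p \in edge_ends C f -> p \notin edge_ends D f ->
    q \in edge_ends D f -> q f = p f ->
  exists f' g' x, [/\ f' != g', x \in D, flip x f' \in D, flip x g' \in D
    & flip (flip x f') g' \in C /\ forall z, z \in D -> z f' != x f' -> z g' = x g'].
Proof.
have [m] := ubnP (dist q p); elim: m f p q => // m IH f p q0 lt Dp Cp nDp Dq0 qf0.
pose P f p := [pred q | (q \in edge_ends D f) && (q f == p f)].
have Pq0 : P f p q0 by rewrite /= Dq0 qf0 eqxx.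
have [q /andP[Dq /eqP qf] minq] := arg_minnP (dist^~ p) Pq0.
have {lt} lt : dist q p <= m by apply: leq_trans (minq _ Pq0) lt.
have EC x h : x \in edge_ends D h -> x \in edge_ends C h.
  by rewrite !in_edge_ends => /andP[/(subsetP sDC)-> /(subsetP sDC)->].
have nqp : q != p by apply: contraNneq nDp => <-.
have [g ng Cqg] := edge_ends_isometric ampleC (EC _ _ Dq) Cp nqp.
have nfg : f != g by apply: contraNneq ng => <-; rewrite qf.
(* By minimality of [q]: [flip q g] is nearer to [p] and has the same value at [f]. *)
have nDqg : flip q g \notin edge_ends D f.
  apply/negP=> Dqg; have := minq (flip q g).
  by rewrite /= Dqg flip_other // qf eqxx leqNgt dist_flip // => /(_ isT).
have sC : square C q f g by apply: edge_square => //; apply: EC.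
have nsD : ~~ square D q f g.
  apply: contra nDqg => /and4P[_ _ Dg Dfg].
  by rewrite in_edge_ends Dg flipC.
have [Dq1 Dqf] : q \in D /\ flip q f \in D by apply/andP; rewrite -in_edge_ends.
have [Dqg|nDqg1] := boolP (flip q g \in D).
  exists f, g, q; split=> //; split; first by case/and4P: sC.
  move=> z Dz; apply: (missing_pattern nfg sC nsD Dq1 Dqf Dp Dz) => //.
  - by rewrite flip_same; case: (q f).
  - by rewrite flip_other // eq_sym.
  - by rewrite eq_sym.
(* Now [q] is in [D] and its [g]-edge in [C] leaves [D]. As [p] and [q] differ at [g], [D] has a
   [g]-edge; the induction continues with [g], [q] and the end [r] nearest to [q] on its side. *)
have [r0 Dr0] := cubD.1 _ _ _ Dq1 Dp ng.
have Pr0 : P g q (if r0 g == q g then r0 else flip r0 g).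
  rewrite /=; case: ifP => [->|e]; first by rewrite Dr0.
  by rewrite flip_edge_ends Dr0 flip_same; case: (r0 g) (q g) e => [] [].
have [r /andP[Dr /eqP rg] minr] := arg_minnP (dist^~ q) Pr0.
have Cqg1 : q \in edge_ends C g.
  by rewrite in_edge_ends (subsetP sDC) //; case/and4P: sC.
apply: (IH g q r) => //; last by rewrite in_edge_ends (negbTE nDqg1) andbF.
apply: leq_trans lt; apply/proper_card/properP; split; last first.
  by exists g; rewrite !inE // rg eqxx.
(* Where [r] and [q] differ, so do [q] and [p]: a walk from [q] to [r] among the [g]-edges of [C]
   crosses [h] in a square that [D] lacks by the choice of [r], and the pattern missing on [g], [h]
   forces [p h = r h]. *)
apply/subsetP=> h; rewrite !inE => rh.
have nqr : q h != r h by rewrite eq_sym.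
have ngh : g != h by apply: contraNneq rh => <-; rewrite rg.
have [z [Cz Czh zh btw]] :=
  isometric_edge (edge_ends_isometric ampleC) Cqg1 (EC _ _ Dr) nqr.
have nDz : z \notin edge_ends D g.
  apply/negP=> Dz; have := minr z; rewrite /= Dz btw // eqxx => /(_ isT).
  by rewrite leqNgt dist_sym [X in _ < X]dist_sym (dist_between btw nqr zh).
have [Dr1 Drg] : r \in D /\ flip r g \in D by apply/andP; rewrite -in_edge_ends.
suff -> : p h = r h by [].
apply: (missing_pattern ngh (edge_square Cz Czh) _ Dr1 Drg Dq1 Dp) => //.
- by apply: contra nDz => /and4P[Dz Dzg _ _]; rewrite in_edge_ends Dz.
- by rewrite flip_same; case: (r g).
- by rewrite flip_other // eq_sym.
- by rewrite rg eq_sym.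
Qed.

(** From a point of [D] nearest to some [y] in [C] outside [D], a step in [C] towards [y] must leave
    [D]. *)
Lemma exists_leaving_edge : D != set0 -> D != C ->
  exists p f, [/\ p \in D, flip p f \in C & flip p f \notin D].
Proof.
move=> /set0Pn[x0 Dx0] nDC.
have /properP[_ [y Cy nDy]] : D \proper C by rewrite properEneq nDC.
have [x Dx minx] := arg_minnP (P := mem D) (dist^~ y) Dx0.
have nxy : x != y by apply: contraNneq nDy => <-.
have [f nf Cf] := ample_isometric ampleC (subsetP sDC _ Dx) Cy nxy.
exists x, f; split=> //; apply/negP=> /minx.
by rewrite leqNgt dist_flip.
Qed.

End Growth.

(** * Adding a corner *)

(** Any cube of [D] through [v] spans only directions of neighbours of [v], so it lies in
    [cubeset K v], which is therefore the unique largest one. *)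
Lemma corner_step_cube D v (K : {set 'I_n}) : cubeset K v \subset D ->
  (forall i, flip v i \in D -> i \in K) -> corner_step D v.
Proof.
move=> sKD nbr; have vK : v \in cubeset K v.
  by rewrite inE; apply/forallP=> i; rewrite eqxx implybT.
exists (cubeset K v), #|K|; split=> //; first by exists K, v.
- move=> _ _ [K' [b [<- ->]]] sD; rewrite inE => /forallP vK'.
  have vb i : i \notin K' -> v i = b i by move=> iK'; apply/eqP/(implyP (vK' i)).
  have KK : K' \subset K.
    apply/subsetP=> i iK; apply/nbr/(subsetP sD); rewrite inE.
    apply/forallP=> j; apply/implyP=> jK; rewrite flip_other ?vb //.
    by apply: contraNneq jK => ->.
  split; first exact: subset_leq_card.
  move=> cK; have eK : K' = K by apply/eqP; rewrite eqEcard KK cK leqnn.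
  rewrite -{}eK in vb *; apply/setP=> y; rewrite !inE; apply: eq_forallb => i.
  by case: (boolP (i \in K')) => //= /vb->.
- move=> y Dy /adjacentP[i e]; rewrite {y}e in Dy *; rewrite inE.
  apply/forallP=> j; apply/implyP=> jK; rewrite flip_other //.
  by apply: contraNneq jK => ->; exact: nbr.
Qed.

Lemma corner_step_vertex v : corner_step [set v] v.
Proof.
apply: (@corner_step_cube _ _ set0) => [|i].
  apply/subsetP=> y; rewrite !inE => /forallP e.
  by apply/eqP/ffunP=> i; have := e i; rewrite inE => /eqP.
by rewrite inE => /eqP/ffunP/(_ i); rewrite flip_same; case: (v i).
Qed.

(** Since [D] is constant on [f], the new vertex has [p] as its only neighbour in [D]. *)
Lemma corner_step_edge D p f : p \in D -> (forall z, z \in D -> z f = p f) ->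
  corner_step (flip p f |: D) (flip p f).
Proof.
move=> Dp Df; apply: (@corner_step_cube _ _ [set f]) => [|i].
  apply/subsetP=> y; rewrite inE => /forallP e.
  have {}e i : i != f -> y i = p i.
    by move=> nif; have := e i; rewrite in_set1 nif flip_other // => /eqP.
  rewrite in_setU1; have [ef|nef] := eqVneq (y f) (p f).
    by rewrite (_ : y = p) ?Dp ?orbT //; apply/ffunP=> i; have [->|/e] := eqVneq i f.
  rewrite (_ : y = flip p f) ?eqxx //; apply/ffunP=> i.
  have [->|nif] := eqVneq i f; last by rewrite flip_other ?e.
  by rewrite flip_same; case: (y f) (p f) nef => [] [].
rewrite in_setU1 in_set1 => /orP[/eqP/ffunP/(_ i)|/Df].
  by rewrite flip_same; case: (flip p f i).
by rewrite flipE flip_same; case: eqVneq; case: (p f).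
Qed.

(** Only patterns shown by [v] can be new. It suffices that [D] shows them already, that the
    required cube is present, or, for a pair, that some pattern is still missing. *)
Lemma cubical2_setU1 D v : cubical2 D ->
    (forall k, (exists2 z, z \in D & z k = v k) \/
               exists z, z \in edge_ends (v |: D) k) ->
    (forall k l, k != l ->
       [\/ exists z, [/\ z \in D, z k = v k & z l = v l],
          exists z, square (v |: D) z k l
        | exists a b, forall z, z \in v |: D -> z k = a -> z l != b]) ->
  cubical2 (v |: D).
Proof.
move=> [cub1 cub2] new1 new2; have sub x : x \in D -> x \in v |: D by apply: setU1r.
split=> [x y k Dx Dy nxy|k l nkl pat].
  have [[z0 Dz0 zk]|//] := new1 k.
  have old x' : x' \in v |: D -> exists2 z, z \in D & z k = x' k.
    by case/setU1P=> [->|]; [exists z0|exists x'].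
  have [x' Dx' ex] := old x Dx; have [y' Dy' ey] := old y Dy.
  have [|z] := cub1 x' y' k Dx' Dy'; first by rewrite ex ey.
  by rewrite in_edge_ends => /andP[Dz Dzk]; exists z; rewrite in_edge_ends !sub.
have [[z0 [Dz0 zk zl]]|//|[a [b miss]]] := new2 k l nkl; last first.
  by have [z [Dz za zb]] := pat a b; have := miss z Dz za; rewrite zb eqxx.
have [a b|z /and4P[D0 D1 D2 D3]] := cub2 k l nkl.
  have [z [/setU1P[->|Dz] <- <-]] := pat a b; first by exists z0.
  by exists z.
by exists z; apply/and4P; split; apply: sub.
Qed.

Lemma cubical2_edge D p f : p \in D -> (forall z, z \in D -> z f = p f) ->
  cubical2 D -> cubical2 (flip p f |: D).
Proof.
move=> Dp Df cub; apply: cubical2_setU1 cub _ _ => [k|k l nkl].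
  have [->|nk] := eqVneq k f; last by left; exists p; rewrite // flip_other.
  by right; exists p; rewrite in_edge_ends setU11 setU1r.
(* The new vertex alone has value [~~ p f] at [f], so this value occurs with only one value at
   [j]. *)
have miss z j : z \in flip p f |: D -> z f = ~~ p f -> z j != ~~ flip p f j.
  case/setU1P=> [->|/Df->]; first by case: (flip p f j).
  by case: (p f).
have [->|nk] := eqVneq k f; first by apply: Or33; exists (~~ p f), (~~ flip p f l) => z; apply: miss.
have [->|nl] := eqVneq l f; last by apply: Or31; exists p; rewrite !flip_other.
apply: Or33; exists (~~ flip p f k), (~~ p f) => z Dz zk.
by apply/negP=> /eqP/(miss z k Dz); rewrite zk eqxx.
Qed.

(** No point of [D] shows the pattern of the new vertex on [f], [g], and flipping any third
    coordinate would keep that pattern. *)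
Lemma corner_step_square D x f g : f != g ->
    x \in D -> flip x f \in D -> flip x g \in D ->
    (forall z, z \in D -> z f != x f -> z g = x g) ->
  corner_step (flip (flip x f) g |: D) (flip (flip x f) g).
Proof.
move=> nfg Dx Dxf Dxg Dfg; have ngf : g != f by rewrite eq_sym.
set v := flip (flip x f) g.
have vf : v f = ~~ x f by rewrite flip_other // flip_same.
have vg : v g = ~~ x g by rewrite flip_same flip_other.
have vo i : i != f -> i != g -> v i = x i by move=> nf ng; rewrite !flip_other.
apply: (@corner_step_cube _ _ [set f; g]) => [|i].
  apply/subsetP=> y; rewrite inE => /forallP e.
  have {}e i : i != f -> i != g -> y i = x i.
    move=> nf ng; rewrite -vo //; apply/eqP; have := e i.
    by rewrite !inE negb_or nf ng.
  have ext z : y f = z f -> y g = z g -> (forall i, i != f -> i != g -> z i = x i) -> y = z.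
    move=> ef eg eo; apply/ffunP=> i; have [->//|nf] := eqVneq i f.
    by have [->//|ng] := eqVneq i g; rewrite e // eo.
  rewrite in_setU1; have [ef|nf] := eqVneq (y f) (x f); have [eg|ng] := eqVneq (y g) (x g).
  - by rewrite (ext x) ?Dx ?orbT.
  - rewrite (ext (flip x g)) ?Dxg ?orbT //; first by rewrite flip_other.
      by rewrite flip_same; case: (y g) (x g) ng => [] [].
    by move=> i _ nig; rewrite flip_other.
  - rewrite (ext (flip x f)) ?Dxf ?orbT //; last 1 first.
    + by move=> i nif _; rewrite flip_other.
    + by rewrite flip_same; case: (y f) (x f) nf => [] [].
    by rewrite flip_other.
  rewrite (ext v) ?eqxx // ?vf ?vg.
    by case: (y f) (x f) nf => [] [].
  by case: (y g) (x g) ng => [] [].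
rewrite in_setU1 in_set2 => /orP[/eqP/ffunP/(_ i)|/Dfg].
  by rewrite flip_same; case: (v i).
have [//|nif] := eqVneq i f; have [//|nig] := eqVneq i g.
have -> : flip v i f = v f by rewrite [LHS]flip_other // eq_sym.
have -> : flip v i g = v g by rewrite [LHS]flip_other // eq_sym.
by rewrite vf vg; case: (x f) (x g) => [] [] /(_ isT).
Qed.

(** The new vertex agrees with [flip x g] off [f] and with [flip x f] off [g], so only its pattern
    on the pair [f], [g] can be new, and there the square is now complete. *)
Lemma cubical2_square D x f g : f != g ->
    x \in D -> flip x f \in D -> flip x g \in D ->
  cubical2 D -> cubical2 (flip (flip x f) g |: D).
Proof.
move=> nfg Dx Dxf Dxg cub; set v := flip (flip x f) g.
have off_f k : k != f -> flip x g k = v k.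
  by move=> nk; rewrite /v flipC [RHS]flip_other.
have off_g k : k != g -> flip x f k = v k by move=> nk; rewrite [RHS]flip_other.
apply: cubical2_setU1 cub _ _ => [k|k l nkl].
  have [->|nk] := eqVneq k f; left; last by exists (flip x g); rewrite // off_f.
  by exists (flip x f); rewrite // off_g.
have sq : square (v |: D) x f g.
  by apply/and4P; split; [exact: setU1r..|exact: setU11].
have [kf|nkf] := eqVneq k f; have [lg|nlg] := eqVneq l g.
- by apply: Or32; exists x; rewrite kf lg.
- by apply: Or31; exists (flip x f); rewrite !off_g ?kf.
- have [kf'|nlf] := eqVneq l f; last by apply: Or31; exists (flip x g); rewrite !off_f.
  by rewrite -kf' lg eqxx in nfg.
have [kg|nkg] := eqVneq k g; last by apply: Or31; exists (flip x f); rewrite !off_g.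
have [lf|nlf] := eqVneq l f; last by apply: Or31; exists (flip x g); rewrite !off_f.
apply: Or32; exists x; rewrite kg lf.
by case/and4P: sq => D0 D1 D2 D3; apply/and4P; rewrite flipC.
Qed.

Lemma grow_corner C D : ample C -> vc_le2 C -> D \subset C -> cubical2 D ->
    D != set0 -> D != C ->
  exists v, [/\ v \in C, v \notin D, cubical2 (v |: D) & corner_step (v |: D) v].
Proof.
move=> am vc sDC cub D0 nDC.
have [p [f [Dp Cpf nDpf]]] := exists_leaving_edge am sDC D0 nDC.
have [/existsP[y /andP[Dy nyf]]|cst] := boolP [exists y in D, y f != p f]; last first.
  have Df z : z \in D -> z f = p f.
    move=> Dz; apply/eqP; apply: contraNT cst => nz.
    by apply/existsP; exists z; rewrite Dz.
  by exists (flip p f); split; [| |exact: cubical2_edge|exact: corner_step_edge].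
have [q0 Dq0] := cub.1 _ _ _ Dy Dp nyf.
have [q Dq qf] : exists2 q, q \in edge_ends D f & q f = p f.
  have [e|ne] := eqVneq (q0 f) (p f); first by exists q0.
  by exists (flip q0 f); rewrite ?flip_edge_ends // flip_same; case: (q0 f) (p f) ne => [] [].
have Cp : p \in edge_ends C f by rewrite in_edge_ends (subsetP sDC).
have nDp : p \notin edge_ends D f by rewrite in_edge_ends (negbTE nDpf) andbF.
have [f' [g [x [nfg Dx Dxf Dxg [Cx miss]]]]] :=
  exists_corner_square am vc sDC cub Dp Cp nDp Dq qf.
exists (flip (flip x f') g); split=> //.
- apply/negP=> /miss; rewrite flip_same (flip_other _ nfg) flip_same.
  rewrite flip_other 1?eq_sym //.
  by case: (x f') (x g) => [] [] /(_ isT).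
- exact: cubical2_square.
- exact: corner_step_square.
Qed.

(** * Peeling orders and maximum classes *)

Lemma corner_peelable_setU1 D v : v \notin D -> corner_step (v |: D) v ->
  corner_peelable D -> corner_peelable (v |: D).
Proof.
move=> nDv stv [s [us es ps]]; exists (v :: s); split.
- by rewrite /= es nDv.
- by move=> x; rewrite in_cons in_setU1 es.
case=> [_|t ts]; first by rewrite (_ : _ :\: _ = v |: D) //; apply/setP=> x; rewrite !inE.
rewrite (_ : _ :\: _ = D :\: [set x in take t s]); last first.
  apply/setP=> x; rewrite !inE; have [->|_] := eqVneq x v; last by [].
  by rewrite (negbTE nDv) andbF.
(* The default of [nth] is the head of the sequence, now [v]; as [t] is in range, both defaults give
   the same vertex. *)
by rewrite /= (set_nth_default (nth [ffun=> false] s 0)) //; apply: ps.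
Qed.

Lemma ample_peelable C D : ample C -> vc_le2 C -> D \subset C -> cubical2 D ->
  D != set0 -> corner_peelable D -> corner_peelable C.
Proof.
move=> am vc; have [m] := ubnP #|C :\: D|; elim: m D => // m IH D lt sDC cub D0 pD.
have [<-//|nDC] := eqVneq D C.
have [v [Cv nDv cubv stv]] := grow_corner am vc sDC cub D0 nDC.
apply: (IH (v |: D)) => //.
- rewrite ltnS in lt; apply: leq_trans lt; apply/proper_card/properP; split.
    by apply/setDS/subsetUr.
  by exists v; rewrite !inE ?eqxx // nDv.
- by apply/subsetP=> x /setU1P[->|/(subsetP sDC)].
- by apply/set0Pn; exists v; rewrite setU11.
- exact: corner_peelable_setU1.
Qed.

Lemma corner_peelable0 : corner_peelable (set0 : {set point n}).
Proof. by exists [::]; split=> // x; rewrite inE. Qed.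

Lemma corner_peelable1 v : corner_peelable [set v].
Proof.
rewrite -(setU0 [set v]); apply: corner_peelable_setU1 corner_peelable0; first by rewrite inE.
by rewrite setU0; apply: corner_step_vertex.
Qed.

Lemma cubical2_set1 v : cubical2 [set v].
Proof.
split=> [x y f /set1P-> /set1P->|f g _ pat]; first by rewrite eqxx.
by have [z [/set1P-> + _]] := pat (~~ v f) true; case: (v f).
Qed.

(** Every shattered set has at most two elements, and the number of all such sets is exactly the
    size of [C]. *)
Lemma maximum_VC2_ample C : maximum_VC2 C -> ample C /\ vc_le2 C.
Proof.
move=> [[_ vc] cC]; have vc2 : vc_le2 C by move=> S /shatters_shattered/vc.
split=> //; rewrite /ample cC.
pose L k := [set S : {set 'I_n} | #|S| == k].
have cL k : #|L k| = 'C(n, k) by rewrite card_draws card_ord.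
have -> : 1 + n + 'C(n, 2) = #|L 0| + #|L 1| + #|L 2| by rewrite !cL bin0 bin1.
apply: (@leq_trans #|L 0 :|: L 1 :|: L 2|).
  apply/subset_leq_card/subsetP=> S; rewrite !inE => /vc2.
  by case: #|S| => [|[|[|]]].
apply: leq_trans (leq_card_setU _ _) _; rewrite leq_add2r.
exact: leq_card_setU.
Qed.

End Points.

Theorem theorem7 (n : nat) (C : {set point n}) :
  maximum_VC2 C -> corner_peelable C.
Proof.
move=> maxC; have [am vc] := maximum_VC2_ample maxC.
have /card_gt0P[c Cc] : 0 < #|C| by rewrite maxC.2.
apply: (ample_peelable am vc _ (cubical2_set1 c) _ (corner_peelable1 c)).
  by rewrite sub1set.
by apply/set0Pn; exists c; rewrite set11.
Qed.
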